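(* Let $\mathbb{K}=\mathbb{R}$ or $\mathbb{C}$. The Lie antialgebra $\mathrm{asl}_2(\mathbb{K})$ has no non-trivial finite-dimensional representations; that is, if $(V,\chi)$ is a representation of $\mathrm{asl}_2(\mathbb{K})$ with $\dim V<\infty$, then $\chi_x=0$ for all $x\in\mathrm{asl}_2(\mathbb{K})$.
   Context: The Lie antialgebra $\mathrm{asl}_2(\mathbb{K})$ is the $\mathbb{Z}_2$-graded $\mathbb{K}$-vector space with even part spanned by $\varepsilon$ and odd part spanned by $a,b$, with the bilinear product $\varepsilon\cdot\varepsilon=\varepsilon$, $\varepsilon\cdot a=a\cdot\varepsilon=\tfrac12 a$, $\varepsilon\cdot b=b\cdot\varepsilon=\tfrac12 b$, $a\cdot b=-b\cdot a=\tfrac12\varepsilon$, and $a\cdot a=b\cdot b=0$. A representation of $\mathrm{asl}_2(\mathbb{K})$ is a pair $(V,\chi)$ with $V=V_0\oplus V_1$ a $\mathbb{Z}_2$-graded $\mathbb{K}$-vector space and $\chi:\mathrm{asl}_2(\mathbb{K})\to\mathrm{End}(V)$ an even (parity-preserving) linear map such that $\chi_x\chi_y+(-1)^{p(x)p(y)}\chi_y\chi_x=\chi_{x\cdot y}$ for all homogeneous $x,y$, where $p$ denotes parity. A representation is trivial if $\chi=0$. *)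

(* Defs.v *)
From mathcomp Require Import all_boot all_order all_algebra.
From mathcomp Require Import reals complex ring.

Set Implicit Arguments.
Unset Strict Implicit.
Unset Printing Implicit Defensive.

Import GRing.Theory.

Local Open Scope ring_scope.

(* Any two models of [realType] are isomorphic, so [R] stands for the real
   numbers and [R[i]] for the complex numbers. *)
Variant real_or_complex (R : realType) : fieldType -> Prop :=
  | IsReal : real_or_complex R R
  | IsComplex : real_or_complex R R[i].

(* (e, (s, t)) encodes e *: eps + s *: a + t *: b. *)
Definition asl2 (K : fieldType) : vectType K := (K^o * (K^o * K^o))%type.

Section Asl2.
Variable K : fieldType.
Implicit Types x y : asl2 K.

Definition asl2_eps : asl2 K := (1, (0, 0)).
Definition asl2_a : asl2 K := (0, (1, 0)).
Definition asl2_b : asl2 K := (0, (0, 1)).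

(* The parity [false] is even and [true] is odd. *)
Definition asl2_part (p : bool) : {vspace asl2 K} :=
  if p then <<[:: asl2_a; asl2_b]>>%VS else <[asl2_eps]>%VS.

(* The bilinear extension of the multiplication table [asl2_table]. *)
Definition asl2_mul x y : asl2 K :=
  let: (e, (s, t)) := x in let: (e', (s', t')) := y in
  (e * e' + 2^-1 * (s * t' - t * s'),
   (2^-1 * (e * s' + s * e'), 2^-1 * (e * t' + t * e'))).

Lemma asl2_mul_linearl y : linear (asl2_mul^~ y).
Proof.
move=> k [e [s t]] [e' [s' t']]; case: y => [f [u v]].
by congr (_, (_, _)); rewrite /= /GRing.scale /=; ring.
Qed.

Lemma asl2_mul_linearr x : linear (asl2_mul x).
Proof.
move=> k [e [s t]] [e' [s' t']]; case: x => [f [u v]].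
by congr (_, (_, _)); rewrite /= /GRing.scale /=; ring.
Qed.

Lemma asl2_table :
  [/\ asl2_mul asl2_eps asl2_eps = asl2_eps,
      asl2_mul asl2_eps asl2_a = 2^-1 *: asl2_a /\
      asl2_mul asl2_a asl2_eps = 2^-1 *: asl2_a,
      asl2_mul asl2_eps asl2_b = 2^-1 *: asl2_b /\
      asl2_mul asl2_b asl2_eps = 2^-1 *: asl2_b,
      asl2_mul asl2_a asl2_b = 2^-1 *: asl2_eps /\
      asl2_mul asl2_b asl2_a = - (2^-1 *: asl2_eps) &
      asl2_mul asl2_a asl2_a = 0 /\ asl2_mul asl2_b asl2_b = 0].
Proof.
by do !split; congr (_, (_, _));
  rewrite /= /GRing.scale /=
    ?(mulr0, mul0r, mulr1, mul1r, addr0, add0r, subr0, sub0r, mulrN1, oppr0).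
Qed.

End Asl2.

(* A grading V = V_0 (+) V_1, with V_p = [gpart p]. *)
Record Z2grading (K : fieldType) (V : vectType K) := {
  gpart :> bool -> {vspace V};
  gpart_full : (gpart false + gpart true)%VS = fullv;
  gpart_direct : directv (gpart false + gpart true)
}.

(* The zero vector is homogeneous of both parities; both conditions below hold
   trivially for it. *)
Record asl2_rep (K : fieldType) (V : vectType K) := {
  rep_grading : Z2grading V;
  rep_map :> {linear asl2 K -> 'End(V)};
  rep_even : forall (p q : bool) (x : asl2 K) (v : V),
    x \in asl2_part K p -> v \in rep_grading q ->
    rep_map x v \in rep_grading (p (+) q);
  rep_mul : forall (p q : bool) (x y : asl2 K),
    x \in asl2_part K p -> y \in asl2_part K q ->
    (rep_map x \o rep_map y)%VF
      + (-1) ^+ (p * q) *: (rep_map y \o rep_map x)%VF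
    = rep_map (asl2_mul x y)
}.

(* Main.v *)
(** With E, A, B the images of eps, a, b, the defining identities read
    2E^2 = E, AB - BA = E/2, EA + AE = A/2 and EB + BE = B/2.  So 2E is an
    idempotent of trace 0; the trace of an idempotent is its rank, whence E = 0
    in characteristic 0, and then A = B = 0. *)
Require Import Defs.
From mathcomp Require Import all_boot all_order all_algebra.
From mathcomp Require Import reals complex.

Import GRing.Theory passmx.
Local Open Scope ring_scope.

(** Factor [P] as C R through its rank, with C left-cancellable and R right-cancellable. Then C R C
    R = C R gives R C = 1, an identity matrix of size [\rank P], and R C has the same trace as C
    R. *)
Lemma mxtrace_idempotent (F : fieldType) n (P : 'M[F]_n) :
  P *m P = P -> \tr P = (\rank P)%:R.
Proof.
move=> PP; rewrite -{1}(mulmx_base P) mxtrace_mulC -mxtrace1; congr (\tr _).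
apply: (row_full_inj (col_base_full P)); apply: (row_free_inj (row_base_free P)).
have CR := mulmx_base P; rewrite /= mulmx1 CR -[RHS]PP -[in RHS]CR.
by rewrite !mulmxA.
Qed.

(** The trace is the rank read in [F], and characteristic 0 makes the rank itself vanish; in
    characteristic p, the identity of size p is a counterexample. *)
Lemma idempotent_mxtrace_eq0 (F : fieldType) n (P : 'M[F]_n) :
  [pchar F] =i pred0 -> P *m P = P -> \tr P = 0 -> P = 0.
Proof.
move=> F0 PP; rewrite mxtrace_idempotent // => /eqP.
by rewrite ((pcharf0P F).1 F0) mxrank_eq0 => /eqP.
Qed.

Lemma half_commutator_eq0 (F : fieldType) n (E A B : 'M[F]_n) :
  [pchar F] =i pred0 -> E *m E + E *m E = E ->
  A *m B - B *m A = 2^-1 *: E -> E = 0.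
Proof.
move=> F0 EE AB; have two_neq0 : 2 != 0 :> F by rewrite ((pcharf0P F).1 F0).
suff : E + E = 0.
  by move/eqP; rewrite -mulr2n -scaler_nat scaler_eq0 (negPf two_neq0) => /eqP.
apply: idempotent_mxtrace_eq0 => //; first by rewrite mulmxDl mulmxDr EE.
have /eqP := congr1 mxtrace AB.
rewrite linearB /= (mxtrace_mulC B) subrr mxtraceZ eq_sym mulf_eq0 invr_eq0.
by rewrite (negPf two_neq0) /= => /eqP trE; rewrite mxtraceD trE addr0.
Qed.

Lemma real_or_complex_pchar0 (R : realType) (K : fieldType) :
  real_or_complex R K -> [pchar K] =i pred0.
Proof. by case; exact: Num.Theory.pchar_num. Qed.

Lemma asl2_eps_even (K : fieldType) : asl2_eps K \in asl2_part K false.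
Proof. exact: memv_line. Qed.

Lemma asl2_a_odd (K : fieldType) : asl2_a K \in asl2_part K true.
Proof. by apply: memv_span; rewrite inE eqxx. Qed.

Lemma asl2_b_odd (K : fieldType) : asl2_b K \in asl2_part K true.
Proof. by apply: memv_span; rewrite !inE eqxx orbT. Qed.

Lemma asl2E (K : fieldType) (x : asl2 K) :
  x = x.1 *: asl2_eps K + (x.2.1 *: asl2_a K + x.2.2 *: asl2_b K).
Proof.
case: x => [e [s t]]; congr (_, (_, _));
by rewrite /= /GRing.scale /= !(mulr0, mulr1, addr0, add0r).
Qed.

Lemma rep_eps_eq0 (K : fieldType) (V : vectType K) (chi : asl2_rep V) :
  [pchar K] =i pred0 -> chi (asl2_eps K) = 0.
Proof.
move=> K0; have [epsM _ _ [abM _] _] := asl2_table K.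
have := rep_mul chi (asl2_eps_even K) (asl2_eps_even K).
have := rep_mul chi (asl2_a_odd K) (asl2_b_odd K).
rewrite epsM abM expr0 expr1 scale1r scaleN1r linearZ /=.
move: (chi _) (chi _) (chi _) => E B A.
(* Finite dimension enters here: a basis of [V] turns the relations into matrix identities, where
   the trace is available. *)
have eV := vbasisP {:V}; set e := vbasis {:V} in eV.
move=> /(congr1 (mxof e e)) AB /(congr1 (mxof e e)) EE.
apply/eqP; rewrite -(mxof_eq0 eV eV); apply/eqP.
move: AB EE; rewrite linearB linearD linearZ /= !(mxof_comp _ _ eV) => AB EE.
(* Matrices act on row vectors, so [mxof] reverses composition: the lemma is applied with the
   matrices of [A] and [B] exchanged. *)
exact: half_commutator_eq0 K0 EE AB.
Qed.

(** Both products in the relation for eps and [x] contain the image of eps, which is 0, so half of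
    [chi x] vanishes. *)
Lemma rep_odd_eq0 (K : fieldType) (V : vectType K) (chi : asl2_rep V) x :
  [pchar K] =i pred0 -> x \in asl2_part K true ->
  asl2_mul (asl2_eps K) x = 2^-1 *: x -> chi x = 0.
Proof.
move=> K0 x1 xM; have := rep_mul chi (asl2_eps_even K) x1.
rewrite xM rep_eps_eq0 // comp_lfun0l comp_lfun0r scaler0 addr0 linearZ /=.
by move/esym/eqP; rewrite scaler_eq0 invr_eq0 ((pcharf0P K).1 K0) => /eqP.
Qed.

Theorem theorem2 (R : realType) (K : fieldType) (hK : real_or_complex R K)
  (V : vectType K) (chi : asl2_rep V) (x : asl2 K) : chi x = 0.
Proof.
have K0 := real_or_complex_pchar0 _ _ hK.
have [_ [epsaM _] [epsbM _] _ _] := asl2_table K.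
rewrite [x]asl2E !linearD !linearZ /= rep_eps_eq0 //.
rewrite (rep_odd_eq0 _ _ chi _ K0 (asl2_a_odd K) epsaM).
by rewrite (rep_odd_eq0 _ _ chi _ K0 (asl2_b_odd K) epsbM) !scaler0 !addr0.
Qed.
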